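(* For any $n\geq 3$ there is a tight enumeration of the vertices of $Q_{n,[k,l]}$ in each of the following cases: (i) $0=k<l\leq n$ or $0\leq k<l=n$. (ii) $1\leq k<l\leq n$ and $l-k\geq 2$ is even. (iiia) $1\leq k<l\leq n-1$ and $l-k=1$. (iiib) $1\leq k<l\leq \lceil n/2\rceil$ or $\lfloor n/2\rfloor \leq k<l\leq n-1$, and $l-k\geq 3$ is odd. (iv) $1\leq k<l\leq n-1$ and $l-k\geq 3$ is odd, under the additional assumption that, with $c:=(l-k-1)/2$, the graph $Q_{2m+1,[m-c,m+1+c]}$ has a Hamilton cycle for all $m=c,c+1,\ldots,(\min(k+l,2n-k-l)-1)/2$.
   Context: The cube $Q_n$ is the graph whose vertices are all bitstrings of length $n$, with an edge between any two bitstrings that differ in exactly one bit. The weight of a bitstring is its number of 1s; the $k$-th level of $Q_n$ is the set of vertices of weight $k$. For integers $0\leq k\leq l\leq n$, $Q_{n,[k,l]}$ denotes the subgraph of $Q_n$ induced by all levels $k,k+1,\ldots,l$. This graph is bipartite, with the two partition classes given by the parity of the weight of the vertices. For a bipartite graph $G$, $v(G)$ is the number of vertices of $G$ and $\delta(G)$ is the difference between the sizes of the larger and the smaller partition class. An enumeration of the vertices of $Q_{n,[k,l]}$ is a sequence $C$ that contains each vertex of $Q_{n,[k,l]}$ exactly once; it is regarded cyclically, i.e., the successor $s_C(u)$ of the last entry $u$ is the first entry. Writing $d(x,y)$ for the Hamming distance (number of positions in which $x$ and $y$ differ), the total distance of $C$ is $\sum_{u\in C} d(u,s_C(u))$. A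 tight enumeration is an enumeration $C$ whose total distance equals $v(Q_{n,[k,l]})+\delta(Q_{n,[k,l]})$, which is a lower bound on the total distance of any enumeration. Equivalently, all steps between cyclically consecutive vertices have Hamming distance 1 or 2, and there are exactly $\delta(Q_{n,[k,l]})$ distance-2 steps, all within the same partition class. *)

(* Defs.v *)
From mathcomp Require Import all_boot.

Set Implicit Arguments.
Unset Strict Implicit.
Unset Printing Implicit Defensive.

Section Cube.

Variable n : nat.
Implicit Types (x y : n.-tuple bool) (C : seq (n.-tuple bool)).

Definition weight x : nat := count_mem true x.

Definition hamming_dist x y : nat := #|[set i : 'I_n | tnth x i != tnth y i]|.

Definition cube_adj : rel (n.-tuple bool) := [rel x y | hamming_dist x y == 1].

(* The vertex set of Q_{n,[k,l]}; its edges are those of [cube_adj] with both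
   ends in this set. *)
Definition cube_levels (k l : nat) : {set n.-tuple bool} :=
  [set x | k <= weight x <= l].

(* v(Q_{n,[k,l]}) *)
Definition num_vertices (k l : nat) : nat := #|cube_levels k l|.

Definition even_class (k l : nat) : {set n.-tuple bool} :=
  [set x in cube_levels k l | ~~ odd (weight x)].

Definition odd_class (k l : nat) : {set n.-tuple bool} :=
  [set x in cube_levels k l | odd (weight x)].

(* delta(Q_{n,[k,l]}) *)
Definition class_diff (k l : nat) : nat :=
  maxn #|even_class k l| #|odd_class k l|
  - minn #|even_class k l| #|odd_class k l|.

Definition enumeration (k l : nat) C : Prop := uniq C /\ C =i cube_levels k l.

(* [next C u] is the cyclic successor s_C(u): the last entry is followed by the
   first one. *)
Definition total_distance C : nat := \sum_(u <- C) hamming_dist u (next C u).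

Definition tight_enumeration (k l : nat) C : Prop :=
  enumeration k l C /\ total_distance C = num_vertices k l + class_diff k l.

End Cube.

(* [C] is a Hamilton cycle of the subgraph of [e] induced by [V]; the size
   condition excludes the degenerate closed walks of length at most 2, which
   [ucycle] accepts. *)
Definition hamilton_cycle (T : finType) (e : rel T) (V : {set T})
    (C : seq T) : Prop :=
  [/\ 3 <= size C, ucycle e C & C =i V].

Definition has_hamilton_cycle (n k l : nat) : Prop :=
  exists C : seq (n.-tuple bool),
    hamilton_cycle (@cube_adj n) (cube_levels n k l) C.

(* Main.v *)
Require Import Defs.
From HB Require Import structures.
From mathcomp Require Import all_boot zify.

(* Words of weight in [k,l] are listed cyclically so that every step has
   distance 1, or distance 2 inside one fixed parity class; counting steps, any
   such list is tight. If [k = 0] or [l - k] is even, restricting the binary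
   reflected Gray code to the levels [k,l] gives such a list, because words of
   extremal weight that become adjacent have distance 2.
   For [l - k] odd and [k + l <= n] the larger class is the one of level [l].
   Lists for [n; k+1,l+1] and [n; k,l], prefixed with 0 and 1 respectively, are
   joined: after permuting coordinates one removes an edge [a b] between the two
   top levels of the first, a distance-2 step [a z] inside the top level of the
   second, with [z] below [b], and adds [0a 1a] and [1z 0b]. The new steps are
   again such a top edge and such a top step, so the induction continues. Its
   base cases are the assumed Hamilton cycles in (iv), the middle levels theorem
   in (iiia), and in (iiib) a list for [k,l-2] joined to a Hamilton cycle of the
   middle levels [l-1,l] for [n = 2l-1].
   Middle levels theorem: for a Dyck word [t] (a plane tree) with [m] edges there
   is a path [spath t] from [1t] to [t0], and these paths partition the middle
   levels of the cube of dimension [2m+1]. As [t0] is adjacent to [1s] for the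
   rotation [s = u1v0] of [t = 1u0v], they close up to cycles, one per plane tree
   up to rotation. For [110u0v] and [101u0v] a 6-cycle allows one to exchange the
   successors of the two paths; these pairs are disjoint, and they connect all
   plane trees, so suitable exchanges merge all cycles into one. *)

Set Implicit Arguments.
Unset Strict Implicit.
Unset Printing Implicit Defensive.

(** * Words and level cycles *)

Notation word := (seq bool).

Definition wt (x : word) : nat := count_mem true x.

Definition hdist (x y : word) : nat := count (fun c => c.1 != c.2) (zip x y).

Arguments wt : simpl never.
Arguments hdist : simpl never.

Lemma hdist_sym x y : hdist x y = hdist y x.
Proof.
elim: x y => [|a x IH] [|b y] //.
by rewrite /hdist /= -!/(hdist _ _) IH eq_sym.
Qed.

Lemma hdistxx x : hdist x x = 0.
Proof. by rewrite /hdist; elim: x => [|a x] //= ->; rewrite eqxx. Qed.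

Lemma hdist_cat x1 x2 y1 y2 : size x1 = size y1 ->
  hdist (x1 ++ x2) (y1 ++ y2) = hdist x1 y1 + hdist x2 y2.
Proof. by move=> es; rewrite /hdist zip_cat // count_cat. Qed.

Lemma hdist_cons a b x y : hdist (a :: x) (b :: y) = (a != b) + hdist x y.
Proof. by []. Qed.

Lemma hdist_catl z x y : hdist (z ++ x) (z ++ y) = hdist x y.
Proof. by rewrite hdist_cat // hdistxx. Qed.

Lemma hdist_catr z x y : size x = size y ->
  hdist (x ++ z) (y ++ z) = hdist x y.
Proof. by move=> es; rewrite hdist_cat // hdistxx addn0. Qed.

Lemma hdist_eq0 x y : size x = size y -> (hdist x y == 0) = (x == y).
Proof.
elim: x y => [|a x IH] [|b y] //= [es].
by rewrite hdist_cons addn_eq0 IH // eqseq_cons eqb0 negbK.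
Qed.

Lemma wt_cons a x : wt (a :: x) = a + wt x.
Proof. by case: a. Qed.

Lemma wt_cat x y : wt (x ++ y) = wt x + wt y.
Proof. exact: count_cat. Qed.

Lemma wt_size x : wt x <= size x.
Proof. exact: count_size. Qed.

Lemma odd_hdist x y : size x = size y ->
  odd (hdist x y) = odd (wt x) (+) odd (wt y).
Proof.
elim: x y => [|a x IH] [|b y] //= [es].
rewrite hdist_cons !wt_cons !oddD IH //.
by case: a; case: b; case: (odd (wt x)); case: (odd (wt y)).
Qed.

Lemma hdist_triangle x y z : size x = size y -> size y = size z ->
  hdist x z <= hdist x y + hdist y z.
Proof.
elim: x y z => [|a x IH] [|b y] [|c z] //= [e1] [e2].
by rewrite !hdist_cons; have := IH _ _ e1 e2; case: a b c => [] [] []; lia.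
Qed.

Lemma hdist_wt x y : size x = size y -> wt x <= wt y + hdist x y.
Proof.
elim: x y => [|a x IH] [|b y] //= [es].
by rewrite hdist_cons !wt_cons; have := IH _ es; case: a; case: b => /=; lia.
Qed.

(** The parity [p] stays fixed along a whole cycle: it names the only class in which steps of
    distance 2 may occur. *)
Definition step (p : bool) (x y : word) : bool :=
  (hdist x y == 1) ||
  [&& hdist x y == 2, odd (wt x) == p & odd (wt y) == p].

Lemma step_sym p x y : step p x y = step p y x.
Proof. by rewrite /step hdist_sym [(odd _ == p) && _]andbC. Qed.

Definition level_cycle (e : rel word) (n k l : nat) (C : seq word) : Prop :=
  [/\ uniq C, forall x, (x \in C) = (size x == n) && (k <= wt x <= l)
    & cycle e C].

Definition adj : rel word := [rel x y | hdist x y == 1].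

Lemma adj_sym : symmetric adj.
Proof. by move=> x y; rewrite /adj /= hdist_sym. Qed.

Notation tight n k l p := (level_cycle (step p) n k l).

Lemma cycle_sub (T : eqType) (e e' : rel T) C :
    (forall x y, x \in C -> y \in C -> e x y -> e' x y) ->
  cycle e C -> cycle e' C.
Proof.
move=> ee'; apply: (sub_in_cycle (P := [in C])); last exact/allP.
by move=> x y xC yC; exact: ee'.
Qed.

Lemma level_cycle_catC e n k l s1 s2 :
  level_cycle e n k l (s1 ++ s2) -> level_cycle e n k l (s2 ++ s1).
Proof.
case=> U M C; split; first by rewrite uniq_catC.
  by move=> x; rewrite -M !mem_cat orbC.
by rewrite -[s2 ++ s1]rot_size_cat rot_cycle.
Qed.

(** Traversing the cycle backwards makes a chosen step available in either orientation. *)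
Lemma level_cycle_swap e n k l a b s : symmetric e ->
  level_cycle e n k l [:: a, b & s] -> level_cycle e n k l [:: b, a & rev s].
Proof.
move=> e_sym [U M cC].
have -> : [:: b, a & rev s] = [:: b; a] ++ rev s by [].
apply: level_cycle_catC; have -> : rev s ++ [:: b; a] = rev [:: a, b & s].
  by rewrite !rev_cons -!cats1 -catA.
split; first by rewrite rev_uniq.
  by move=> x; rewrite mem_rev.
by rewrite rev_cycle; apply: sub_cycle cC => x y; rewrite e_sym.
Qed.

Lemma tight_swap n k l p a b s :
  tight n k l p [:: a, b & s] -> tight n k l p [:: b, a & rev s].
Proof. by apply: level_cycle_swap => x y; exact: step_sym. Qed.

Lemma level_cycle_size e n k l C x : level_cycle e n k l C -> x \in C -> size x = n.
Proof. by case=> _ -> _ /andP[/eqP]. Qed.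

Lemma adj_tight n k l p C : level_cycle adj n k l C -> tight n k l p C.
Proof. by case=> U M cC; split=> //; apply: sub_cycle cC => x y xy; apply/orP; left. Qed.

(** * Symmetries of the cube: complement and coordinate permutations *)

Lemma map_negb_K : involutive (map negb : word -> word).
Proof. by move=> x; rewrite mapK //; exact: negbK. Qed.

Lemma wt_negb x : wt (map negb x) = size x - wt x.
Proof.
elim: x => [|a x IH] //=; rewrite !wt_cons IH; have := wt_size x.
by case: a => /=; lia.
Qed.

Lemma hdist_negb x y : hdist (map negb x) (map negb y) = hdist x y.
Proof.
rewrite /hdist; elim: x y => [|a x IH] [|b y] //=.
by rewrite IH; case: a; case: b.
Qed.

(** Complementation turns the levels upside down and changes the parity of every weight by that of
    [n]. It reduces the upper half of the cube to the lower half. *)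
Lemma tight_negb n k l p C : k <= n -> l <= n ->
  tight n k l p C -> tight n (n - l) (n - k) (p (+) odd n) (map (map negb) C).
Proof.
move=> lekn leln [U M cC]; split.
- by rewrite map_inj_uniq //; exact: inv_inj map_negb_K.
- move=> x; rewrite -{1}[x]map_negb_K mem_map; last exact: inv_inj map_negb_K.
  rewrite M size_map wt_negb; have := wt_size x.
  by case: eqP => //= -> le; lia.
- rewrite cycle_map; apply: cycle_sub cC => x y.
  rewrite !M => /andP[/eqP sx _] /andP[/eqP sy _].
  rewrite /step /= hdist_negb !wt_negb !oddB ?wt_size // sx sy.
  case: (hdist x y == 1) => //=; case: (hdist x y == 2) => //=.
  by case: (odd (wt x)); case: (odd (wt y)); case: p; case: (odd n).
Qed.

Section Isometry.

Variables (n : nat) (f : word -> word).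
Hypothesis f_size : forall x, size x = n -> size (f x) = n.
Hypothesis f_wt : forall x, size x = n -> wt (f x) = wt x.
Hypothesis f_hdist :
  forall x y, size x = n -> size y = n -> hdist (f x) (f y) = hdist x y.

Lemma tight_isometry k l p C : tight n k l p C -> tight n k l p (map f C).
Proof.
move=> tC; have sC := level_cycle_size tC; case: tC => U M cC.
have U' : uniq (map f C).
  rewrite map_inj_in_uniq // => x y xC yC exy; apply/eqP.
  by rewrite -hdist_eq0 ?sC // -f_hdist ?sC // exy hdistxx.
split=> //.
(* The image lies in the same levels and has as many distinct words as [C], so it fills them. *)
- have [|_ E] := uniq_min_size U' _ (eq_leq (esym (size_map f C))).
    move=> _ /mapP[x xC ->]; move: (xC) (xC); rewrite {1}M [f x \in _]M => /andP[_ lx].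
    move=> {}/sC sx; by rewrite f_wt // lx f_size // eqxx.
  by move=> x; rewrite E.
- rewrite cycle_map; apply: cycle_sub cC => x y xC yC.
  by rewrite /step /= f_hdist ?f_wt ?sC.
Qed.

End Isometry.

(** The length, the two weights and the distance give four linear equations that determine how often
    each of the four columns occurs. *)
Lemma zip_perm_eq (x y x' y' : word) n : size x = n -> size y = n ->
    size x' = n -> size y' = n -> wt x = wt x' -> wt y = wt y' ->
    hdist x y = hdist x' y' ->
  perm_eq (zip x y) (zip x' y').
Proof.
move=> sx sy sx' sy' wx wy h.
have cnt u v P : size u = size v -> 
  let c a b := count_mem (a, b) (zip u v) in
  [/\ count P (zip u v) = P (true, true) * c true true + P (true, false) * c true false
     + P (false, true) * c false true + P (false, false) * c false false,
     wt u = c true true + c true false, wt v = c true true + c false true,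
     hdist u v = c true false + c false true
   & size u = c true true + c true false + c false true + c false false].
  elim: u v => [|a u IH] [|b v] //=; first by rewrite !muln0; split.
  case=> /IH[E1 E2 E3 E4 E5]; rewrite hdist_cons !wt_cons.
  move: E1 E2 E3 E4 E5 => {IH}.
  move: (count P (zip u v)) (count_mem _ _) (count_mem _ _).
  move: (count_mem _ _) (count_mem _ _).
  move=> z c1 c2 c3 c4 -> -> -> -> ->; split; case: a; case: b => /=; lia. 
apply/permP => P.
have [] := cnt x y P; first by rewrite sx sy.
have [] := cnt x' y' P; first by rewrite sx' sy'.
move: (count_mem _ _) (count_mem _ _) (count_mem _ _) (count_mem _ _).
move=> c1 c2 c3 c4 -> E1 E2 E3 E4.
move: (count_mem _ _) (count_mem _ _) (count_mem _ _) (count_mem _ _).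
move=> d1 d2 d3 d4 -> F1 F2 F3 F4.
rewrite wx E1 in F1; rewrite wy E2 in F2; rewrite h E3 in F3; rewrite sx -sx' E4 in F4.
have [-> -> -> -> //] : [/\ c1 = d1, c2 = d2, c3 = d3 & c4 = d4] by split; lia.
Qed.

(* The coordinates are permuted by [z |-> map (nth false z) s], where [s]
   enumerates the indices. *)
Lemma align_pair n k l p c d C a b :
    tight n k l p [:: c, d & C] -> size a = n -> size b = n ->
    wt a = wt c -> wt b = wt d -> hdist a b = hdist c d ->
  exists C', tight n k l p [:: a, b & C'].
Proof.
move=> tC sa sb wa wb h.
have sc : size c = n by apply: (level_cycle_size tC); rewrite !inE eqxx.
have sd : size d = n by apply: (level_cycle_size tC); rewrite !inE eqxx orbT.
have /(perm_iotaP (false, false))[s ps zs] :=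
  zip_perm_eq sa sb sc sd wa wb h.
rewrite size_zip sc sd minnn in ps.
pose f z := map (nth false z) s.
have szs : size s = n by rewrite (perm_size ps) size_iota.
have sn i : i \in s -> i < n by rewrite (perm_mem ps) mem_iota.
have fz x y : size x = size y -> zip (f x) (f y) = map (nth (false, false) (zip x y)) s.
  by move=> es; rewrite zip_map; apply: eq_map => i; rewrite nth_zip.
have pz x y : size x = n -> size y = n -> perm_eq (zip (f x) (f y)) (zip x y).
  move=> sx sy; rewrite fz ?sx ?sy //.
  apply/(perm_iotaP (false, false)); exists s => //.
  by rewrite size_zip sx sy minnn.
have szf z : size (f z) = n by rewrite size_map.
have fcd : zip (f c) (f d) = zip a b by rewrite fz ?sc.
have fc : f c = a.
  by rewrite -[f c](@unzip1_zip _ _ _ (f d)) ?szf // fcd unzip1_zip ?sa ?sb.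
have fd : f d = b.
  by rewrite -[f d](@unzip2_zip _ _ (f c)) ?szf // fcd unzip2_zip ?sa ?sb.
exists (map f C); rewrite -fc -fd -[_ :: _]/(map f [:: c, d & C]).
apply: tight_isometry tC => [//|x sx|x y sx sy]; last exact/permP/pz.
have /permP/(_ (fun c => c.1)) := pz x x sx sx.
rewrite -!(count_map fst id) -!/(unzip1 _) !unzip1_zip // => e.
by rewrite /wt -!(eq_count (a1 := id)) // => -[].
Qed.

(** * Tightness *)

Lemma hamming_distE n (x y : n.-tuple bool) : hamming_dist x y = hdist x y.
Proof.
rewrite /hamming_dist /hdist -[tval x]map_tnth_enum -[tval y]map_tnth_enum.
by rewrite zip_map count_map cardsE -sum1_card -sum1_count big_enum_cond.
Qed.

Lemma perm_next (T : eqType) (C : seq T) : uniq C -> perm_eq (map (next C) C) C.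
Proof.
move=> U; have U' : uniq (map (next C) C).
  by rewrite map_inj_uniq //; exact: can_inj (prev_next U).
apply: uniq_perm => //; apply: (uniq_min_size U' _ _).2.
  by move=> _ /mapP[x xC ->]; rewrite mem_next.
by rewrite size_map.
Qed.

(** Once the words outside class [p] are counted at the successor, the identity holds for each step
    [x y] separately: d(x,y) + [y outside p] = 1 + [x in p]. *)
Lemma total_distance_step n p (C : seq (n.-tuple bool)) :
    uniq C -> cycle (step p) (map val C) ->
  total_distance C + count (fun x => odd (weight x) != p) C
  = size C + count (fun x => odd (weight x) == p) C.
Proof.
move=> U; rewrite cycle_map => cC.
rewrite -2!sum1_count -sum1_size [X in _ + X = _]big_mkcond [X in _ = _ + X]big_mkcond.
rewrite -[X in _ + X = _](perm_big _ (perm_next U)) big_map /total_distance.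
rewrite -!big_split /= big_seq [RHS]big_seq; apply: eq_bigr => x.
move/(next_cycle cC); move: (next C x) => y /=.
rewrite hamming_distE /step; have := @odd_hdist x y.
rewrite !size_tuple -!/(weight _) => /(_ erefl).
case: eqP => [->|_] /=.
  by case: (odd _); case: (odd _); case: (p).
by case: eqP => [->|] //=; case: (odd _); case: (odd _); case: (p).
Qed.

Lemma tight_tight_enumeration n k l p C : tight n k l p C ->
  exists C' : seq (n.-tuple bool), tight_enumeration k l C'.
Proof.
move=> tC; have sC := level_cycle_size tC; case: tC => U M cC.
pose C' := [seq insubd (nseq_tuple n false) x | x <- C].
have eC : map val C' = C.
  rewrite -map_comp map_id_in // => x xC /=.
  by rewrite insubdK // ?inE; apply/eqP/sC.
have U' : uniq C' by rewrite -(map_inj_uniq val_inj) eC.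
have M' : C' =i cube_levels n k l.
  move=> x; rewrite -(mem_map val_inj) eC M inE.
  by rewrite size_tuple eqxx.
exists C'; split=> //.
have cardC (P : pred (n.-tuple bool)) (A : {set n.-tuple bool}) :
    (forall x, (x \in A) = (x \in cube_levels n k l) && P x) -> #|A| = count P C'.
  move=> AE; rewrite -size_filter -(card_uniqP (filter_uniq P U')).
  by apply: eq_card => x; rewrite mem_filter AE M' andbC.
have := @total_distance_step n p C' U'; rewrite eC => /(_ cC).
(* Steps have length at least 1, so by the preceding count class [p] is at least as large as the
   other one. *)
have td : size C' <= total_distance C'.
  rewrite -sum1_size /total_distance big_seq [X in _ <= X]big_seq; apply: leq_sum => x xC.
  have cC' : cycle (relpre val (step p)) C' by rewrite -cycle_map eC.
  have := next_cycle cC' xC; rewrite /step /= hamming_distE.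
  by case/orP => [/eqP->|/and3P[/eqP->]].
rewrite /num_vertices /class_diff (cardC xpredT) ?count_predT; last first.
  by move=> x; rewrite andbT.
rewrite (cardC (fun x => ~~ odd (weight x))); last by move=> x; rewrite inE.
rewrite (cardC (fun x => odd (weight x))); last by move=> x; rewrite inE.
case: p {cC} => /=.
  under eq_count do rewrite eqb_id.
  under [X in _ = _ + X -> _]eq_count do rewrite eqb_id.
  move: (count _ C') (count _ C') (size C') (total_distance C') td => a b c d; lia.
under eq_count do rewrite eqbF_neg negbK.
under [X in _ = _ + X -> _]eq_count do rewrite eqbF_neg.
move: (count _ C') (count _ C') (size C') (total_distance C') td => a b c d; lia.
Qed.

(** * Trimmed Gray codes and gluing *)

(** The invariants of the gluing. The cycle is rotated so that the step to be cut comes first, and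
    the distance-2 steps belong to the class of the top level. *)
Definition top_edge n k l : Prop := exists a b s,
  [/\ tight n k l (odd l) [:: a, b & s], (wt a).+1 = l & wt b = l].

Definition top_pair n k l : Prop := exists a b s,
  [/\ tight n k l (odd l) [:: a, b & s], wt a = l & wt b = l].

(** The reflected Gray code without the words outside the levels. A leading 1 lowers both bounds,
    where a lower bound 0 stays 0; for [l = 0] the second half is empty. *)
Fixpoint gray n k l : seq word :=
  if n is n'.+1 then
    map (cons false) (gray n' k l) ++
    (if l is l'.+1 then map (cons true) (rev (gray n' k.-1 l')) else [::])
  else if k is 0 then [:: [::]] else [::].

Lemma mem_cons_map (b : bool) (x : word) s :
  (x \in map (cons b) s) = if x is a :: y then (a == b) && (y \in s) else false.
Proof.
case: x => [|a y]; first by apply/mapP => -[].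
apply/mapP/andP => [[z zs [-> ->]]|[/eqP-> ys]]; first by rewrite eqxx.
by exists y.
Qed.

Lemma gray_SS n k l : gray n.+1 k l.+1 =
  map (cons false) (gray n k l.+1) ++ map (cons true) (rev (gray n k.-1 l)).
Proof. by []. Qed.

Lemma mem_gray n k l x : (x \in gray n k l) = (size x == n) && (k <= wt x <= l).
Proof.
elim: n k l x => [|n IH] k l x.
  by case: k => [|k]; case: x => //= b x; rewrite ?inE.
rewrite /= mem_cat mem_cons_map; case: l => [|l].
  by case: x => [|[] x] /=; rewrite ?IH ?wt_cons ?in_nil ?orbF /=; lia.
rewrite mem_cons_map; case: x => [|[] x] //=.
- by rewrite mem_rev IH wt_cons /=; lia.
- by rewrite IH wt_cons /= orbF.
Qed.

Lemma gray_uniq n k l : uniq (gray n k l).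
Proof.
have inj b : injective (cons b : word -> word) by move=> x y [].
elim: n k l => [|n IH] k l; first by case: k.
rewrite /= cat_uniq map_inj_uniq // IH /=.
case: l => [|l] //=.
rewrite map_inj_uniq // rev_uniq IH andbT -all_predC; apply/allP => x /=.
by rewrite !mem_cons_map; case: x => // -[].
Qed.

(** The word of weight [k] at which the trimmed code starts. *)
Definition low_word n k : word := nseq (n - k) false ++ nseq k true.

Lemma low_word_size n k : k <= n -> size (low_word n k) = n.
Proof. by move=> lekn; rewrite size_cat !size_nseq subnK. Qed.

Lemma wt_nseq n b : wt (nseq n b) = b * n.
Proof. by rewrite /wt count_nseq; case: b. Qed.

Lemma low_word_wt n k : wt (low_word n k) = k.
Proof. by rewrite wt_cat !wt_nseq mul0n mul1n. Qed.

Lemma full_word x : size x <= wt x -> x = nseq (size x) true.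
Proof.
elim: x => //= a x IH; rewrite wt_cons; have := wt_size x.
by case: a => [|/leq_ltn_trans le /le]; rewrite ?ltnn //= add1n ltnS => _ /IH <-.
Qed.

Lemma empty_word x : wt x = 0 -> nseq (size x) false = x.
Proof. by elim: x => //= -[] x IH; rewrite wt_cons // => /IH->. Qed.

Lemma gray_head n k l : k <= n -> k <= l ->
  exists s, gray n k l = low_word n k :: s.
Proof.
elim: n k l => [|n IH] k l.
  by rewrite leqn0 => /eqP-> _; exists [::].
rewrite leq_eqVlt => /orP[/eqP-> lenl|]; last first.
  rewrite ltnS => lekn lekl; have [s /= ->] := IH k l lekn lekl.
  by rewrite /low_word subSn //=; eexists.
have := mem_gray n.+1 n.+1 l (nseq n.+1 true).
have := @mem_gray n.+1 n.+1 l.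
case: (gray _ _ _) => [|y s M]; first by rewrite size_nseq wt_nseq eqxx mul1n leqnn lenl.
have := M y; rewrite mem_head => /esym/and3P[/eqP sy wy _] _.
exists s; rewrite /low_word subnn /= [y]full_word ?sy //.
Qed.

Lemma gray_last n k l : k.-1 <= n -> k.-1 <= l ->
  exists s, gray n.+1 k l.+1 = rcons s (true :: low_word n k.-1).
Proof.
move=> lekn lekl; have [s E] := gray_head lekn lekl.
by rewrite /= E rev_cons map_rcons -rcons_cat; eexists.
Qed.

(* The condition [0 < k] reflects that weight 0 occurs only once. *)
Definition gray_step k l (x y : word) :=
  (hdist x y == 1) || (hdist x y == 2) &&
  ([&& 0 < k, wt x == k & wt y == k] || (wt x == l) && (wt y == l)).

Lemma gray_step_sym k l x y : gray_step k l x y = gray_step k l y x.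
Proof.
by rewrite /gray_step hdist_sym [(wt x == k) && _]andbC [(wt x == l) && _]andbC.
Qed.

Lemma gray_step_true k l x y :
  gray_step k.-1 l x y -> gray_step k l.+1 (true :: x) (true :: y).
Proof.
rewrite /gray_step hdist_cons !wt_cons /= !add1n !eqSS.
by case: k => [|[|k]] //=; case: orP => //; lia.
Qed.

Lemma hdist_low_word n k : k < n -> hdist (low_word n k) (low_word n k.+1) = 1.
Proof.
move=> ltkn; rewrite /low_word -(subnSK ltkn) -addn1 nseqD -catA hdist_catl.
by rewrite hdist_cons hdistxx.
Qed.

Lemma sorted_cat (T : eqType) (e : rel T) s1 s2 :
    sorted e s1 -> sorted e s2 ->
    (forall t1 x y t2, s1 = rcons t1 x -> s2 = y :: t2 -> e x y) ->
  sorted e (s1 ++ s2).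
Proof.
case: s2 => [|y t2]; first by rewrite cats0.
case/lastP: s1 => // t1 x s1e s2e /(_ t1 x y t2 erefl erefl) exy.
by rewrite cat_rcons sorted_cat_cons s1e /= exy.
Qed.

Lemma gray_sorted n k l : k <= l -> sorted (gray_step k l) (gray n k l).
Proof.
elim: n k l => [|n IH] k l lekl; first by case: k lekl.
rewrite /=; apply: sorted_cat; first by rewrite sorted_map IH.
  case: l lekl => // l lekl; rewrite sorted_map rev_sorted.
  have /IH : k.-1 <= l by lia.
  apply: sub_sorted => x y /=; rewrite gray_step_sym; exact: gray_step_true.
case: l lekl => // l lekl; move=> t1 x y t2.
case: n {IH} => [|n] E1 E2.
  have : x \in rcons t1 x by rewrite mem_rcons mem_head.
  have : y \in y :: t2 by rewrite mem_head.
  rewrite -E1 -E2 !mem_cons_map; case: x {E1} => // a x; case: y {E2} => // b y.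
  rewrite mem_rev !mem_gray => /andP[/eqP-> /andP[/nilP-> _]].
  by move=> /andP[/eqP-> /andP[/nilP-> _]].
have lekn : k <= n.+1.
  rewrite leqNgt; apply/negP => ltnk.
  have : x \in rcons t1 x by rewrite mem_rcons mem_head.
  rewrite -E1 mem_cons_map; case: x {E1} => // a x.
  rewrite mem_gray => /and4P[_ /eqP sx]; have := wt_size x; rewrite sx; lia.
have [||s E] := @gray_last n k l; [lia|lia|].
move: E1; rewrite E map_rcons => /rcons_inj[_ <-].
(* If the top level is 1, the second half is the single word 10...0, and the two halves meet in a
   distance-2 step inside the top level. *)
case: l lekl E2 {E} => [|l] lekl.
  move=> E; have {E} : y \in map (cons true) (rev (gray n.+1 k.-1 0)).
    by rewrite E mem_head.
  rewrite mem_cons_map; case: y => // b y; rewrite mem_rev mem_gray leqn0.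
  case/and3P => [/eqP-> /eqP sy /andP[_ /eqP wy]].
  rewrite -[y]empty_word // sy.
  have -> : k.-1 = 0 by lia.
  rewrite /gray_step !wt_cons wt_nseq low_word_wt /low_word subn0 cats0.
  by rewrite !hdist_cons hdistxx /= orbT.
(* The halves meet in 01 followed by [low_word n k.-1] and 11 followed by [low_word n k.-2]. For k
   <= 1 the distance is 1; otherwise it is 2 and both words have weight [k]. *)
have [||s' ->] := @gray_last n k.-1 l; [lia|lia|].
rewrite rev_rcons => -[<- _]; rewrite /gray_step !wt_cons !low_word_wt !hdist_cons.
case: k lekn lekl {t1 s t2 s'} => [|[|k]] lekn lekl; rewrite ?hdistxx //=.
by rewrite hdist_sym hdist_low_word //= !eqxx.
Qed.

(** The closing step leads from 1 followed by [low_word n k.-1] to [low_word n.+1 k]: distance 1 for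
    [k = 0], otherwise distance 2 inside the bottom level. *)
Lemma gray_cycle n k l : k < l -> k < n -> cycle (gray_step k l) (gray n k l).
Proof.
case: n l => [|n] [|l] // ltkl ltkn.
have [|//|s E] := @gray_last n k l; [lia|lia|].
have [s' E'] := @gray_head n.+1 k l.+1 (ltnW ltkn) (ltnW ltkl).
have := gray_sorted n.+1 (ltnW ltkl); rewrite /cycle E' /= rcons_path => -> /=.
have -> : last (low_word n.+1 k) s' = true :: low_word n k.-1.
  by rewrite -(last_cons [::]) -E' E last_rcons.
rewrite /gray_step !wt_cons !low_word_wt.
case: k ltkl ltkn {s E s' E'} => [|k] ltkl ltkn.
  by rewrite /low_word /= !subn0 !cats0 hdist_cons hdistxx.
rewrite /low_word subSn ?(ltnW ltkn) //= hdist_cons -/(low_word n k) -/(low_word n k.+1).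
by rewrite hdist_low_word //= add1n !eqxx.
Qed.

Lemma tight_gray n k l p : k < l <= n -> (0 < k -> odd k = p) -> odd l = p ->
  tight n k l p (gray n k l).
Proof.
case/andP=> ltkl leln pk pl; split; first exact: gray_uniq.
  exact: mem_gray.
apply: sub_cycle (gray_cycle ltkl (leq_trans ltkl leln)) => x y.
rewrite /gray_step /step; case: (hdist x y == 1) => //=.
case/andP=> -> /orP[/and3P[k0 /eqP-> /eqP->]|/andP[/eqP-> /eqP->]] /=.
  by rewrite pk // eqxx.
by rewrite pl eqxx.
Qed.

Lemma top_edge_tight n k l : top_edge n k l -> exists C, tight n k l (odd l) C.
Proof. by case=> a [b [s [t _ _]]]; exists [:: a, b & s]. Qed.

(* Both orientations occur, as half of the Gray code is traversed backwards. *)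
Definition has_step (P : nat -> nat -> Prop) (C : seq word) := exists s1 a b s2,
  C = s1 ++ [:: a, b & s2] /\ (P (wt a) (wt b) \/ P (wt b) (wt a)).

Lemma has_step_catl P s C : has_step P C -> has_step P (s ++ C).
Proof. by case=> s1 [a [b [s2 [-> Pab]]]]; exists (s ++ s1), a, b, s2; rewrite catA. Qed.

Lemma has_step_catr P s C : has_step P C -> has_step P (C ++ s).
Proof.
by case=> s1 [a [b [s2 [-> Pab]]]]; exists s1, a, b, (s2 ++ s); rewrite -catA.
Qed.

Lemma has_step_rev P C : has_step P C -> has_step P (rev C).
Proof.
case=> s1 [a [b [s2 [-> Pab]]]]; exists (rev s2), b, a, (rev s1).
split; last by case: Pab; [right|left].
by rewrite rev_cat !rev_cons -!cats1 -!catA.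
Qed.

Lemma has_step_cons P Q (b : bool) C : (forall i j, P i j -> Q (b + i) (b + j)) ->
  has_step P C -> has_step Q (map (cons b) C).
Proof.
move=> PQ [s1 [x [y [s2 [-> Pab]]]]].
exists (map (cons b) s1), (b :: x), (b :: y), (map (cons b) s2).
rewrite map_cat !wt_cons; split=> //.
by case: Pab => Pab; [left|right]; exact: PQ.
Qed.

Lemma gray_edge n l : 0 < l <= n ->
  has_step (fun i j => i.+1 = l /\ j = l) (gray n 0 l).
Proof.
elim: n l => [|n IH] [|[|l]] // /andP[_ leln].
  case: n IH {leln} => [|n] IH.
    by exists [::], [:: false], [:: true], [::]; split=> //; left.
  by apply: has_step_catr; apply: has_step_cons (IH 1 _).
apply: has_step_catl; apply: has_step_cons (has_step_rev (IH l.+1 _)) => //.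
by move=> i j [<- ->].
Qed.

(** For [l = 1] the two halves of the code meet in such a step; for larger [l] one is found in the
    reversed second half, where the prefix 1 raises both weights. *)
Lemma gray_pair n l : 0 < l < n ->
  has_step (fun i j => i = l /\ j = l) (gray n 0 l).
Proof.
elim: n l => [|n IH] [|[|l]] // /andP[_ leln].
  case: n IH leln => [|n] // _ _.
  have [s E] := @gray_last n 0 0 isT isT.
  have [s' E'] := @gray_head n.+1 0 0 isT isT.
  have [y [t Ey]] : exists y t, rev (gray n.+1 0 0) = y :: t.
    by rewrite E' rev_cons; case: (rev s') => [|y t]; do 2!eexists.
  have wy : wt y = 0.
    have : y \in rev (gray n.+1 0 0) by rewrite Ey mem_head.
    by rewrite mem_rev mem_gray leqn0 => /and3P[_ _ /eqP].
  exists (map (cons false) s), [:: false, true & low_word n 0], (true :: y).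
  exists (map (cons true) t).
  rewrite gray_SS E Ey map_rcons cat_rcons.
  by rewrite !wt_cons low_word_wt wy; split=> //; left.
apply: has_step_catl; apply: has_step_cons (has_step_rev (IH l.+1 _)) => //.
by move=> i j [-> ->].
Qed.

Lemma tight_has_step n k l p P C : tight n k l p C -> has_step P C ->
  exists a b s, tight n k l p [:: a, b & s] /\ P (wt a) (wt b).
Proof.
move=> tC [s1 [a [b [s2 [E Pab]]]]]; rewrite E in tC.
have {}tC := level_cycle_catC tC; rewrite /= in tC.
case: Pab => Pab; first by exists a, b, (s2 ++ s1).
by exists b, a, (rev (s2 ++ s1)); split=> //; exact: tight_swap.
Qed.

Lemma top_edge_gray n l : 0 < l <= n -> top_edge n 0 l.
Proof.
move=> le; have tC : tight n 0 l (odd l) (gray n 0 l) by exact: tight_gray.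
have [a [b [s [{}tC [wa wb]]]]] := tight_has_step tC (gray_edge le).
by exists a, b, s.
Qed.

Lemma top_pair_gray n l : 0 < l < n -> top_pair n 0 l.
Proof.
move=> lt; have tC : tight n 0 l (odd l) (gray n 0 l).
  by apply: tight_gray => //; lia.
have [a [b [s [{}tC [wa wb]]]]] := tight_has_step tC (gray_pair lt).
by exists a, b, s.
Qed.

Lemma drop_one (x : word) : 0 < wt x -> exists y,
  [/\ size y = size x, (wt y).+1 = wt x & hdist y x = 1].
Proof.
elim: x => // -[] x IH; rewrite wt_cons => wx.
  by exists (false :: x); rewrite wt_cons hdist_cons hdistxx.
have [y [sy wy h]] := IH wx.
by exists (false :: y); rewrite !wt_cons hdist_cons h /= sy.
Qed.

Lemma drop_two (x : word) : 1 < wt x -> exists y z,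
  [/\ size y = size x, size z = size x, (wt y).+1 = wt x, (wt z).+1 = wt x
    & [/\ hdist y x = 1, hdist z x = 1 & hdist y z = 2]].
Proof.
elim: x => // -[] x IH; rewrite wt_cons => wx.
  have [y [sy wy h]] := @drop_one x wx.
  exists (false :: x), (true :: y).
  by rewrite !wt_cons !hdist_cons hdistxx h -wy [hdist x y]hdist_sym h /= sy.
have [y [z [sy sz wy wz [h1 h2 h3]]]] := IH wx.
exists (false :: y), (false :: z).
by rewrite !wt_cons !hdist_cons h1 h2 h3 /= sy sz.
Qed.

Lemma drop_other (x y : word) : (wt x).+1 = wt y -> hdist x y = 1 ->
    size x = size y -> 0 < wt x -> exists z,
  [/\ size z = size x, wt z = wt x, hdist z y = 1 & hdist x z = 2].
Proof.
elim: x y => [|a x IH] [|b y] //; rewrite !wt_cons hdist_cons => w h [s].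
case: a b w h => [] [] //=.
- rewrite !add1n add0n => -[w] h _.
  exists (false :: y); rewrite wt_cons hdist_cons hdistxx /=.
  by rewrite hdist_cons h s w.
- move=> w h _; have : hdist x y = 0 by lia.
  move/eqP; rewrite hdist_eq0 // => /eqP exy; subst y; lia.
- rewrite add0n add1n => -[w] [/eqP]; rewrite hdist_eq0 // => /eqP <-.
  rewrite ?add0n => wx; have [z [sz wz h]] := drop_one wx.
  by exists (true :: z); rewrite !wt_cons !hdist_cons h [hdist x z]hdist_sym h /= sz add1n wz.
- rewrite ?add0n => w h wx; have [z [sz wz h1 h2]] := IH y w h s wx.
  by exists (false :: z); rewrite !wt_cons !hdist_cons h1 h2 /= sz.
Qed.

Lemma tight_join n k l p C0 C1 C :
    tight n k.+1 l.+1 p C0 -> tight n k l (~~ p) C1 ->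
    perm_eq C (map (cons false) C0 ++ map (cons true) C1) ->
  cycle (step p) C -> tight n.+1 k.+1 l.+1 p C.
Proof.
case=> U0 M0 _ [U1 M1 _] pC cC; split=> //.
  have inj b : injective (cons b : word -> word) by move=> x y [].
  rewrite (perm_uniq pC) cat_uniq !map_inj_uniq // U0 U1 andbT -all_predC.
  by apply/allP => x /=; rewrite !mem_cons_map; case: x => // -[].
move=> x; rewrite (perm_mem pC) mem_cat !mem_cons_map.
by case: x => [|[] x] //=; rewrite ?M0 ?M1 !wt_cons ?orbF.
Qed.

Lemma path_map_cons p p' b x s : p' = b (+) p ->
  path (step p) (b :: x) (map (cons b) s) = path (step p') x s.
Proof.
move=> ->; rewrite path_map; apply: eq_path => y z.
rewrite /step /= hdist_cons eqxx !wt_cons !oddD.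
by case: b; case: p; case: (odd (wt y)); case: (odd (wt z)).
Qed.

Lemma glue_levels n k l : 0 < l ->
    top_edge n k.+1 l.+1 -> top_pair n k l ->
  top_edge n.+1 k.+1 l.+1 /\ top_pair n.+1 k.+1 l.+1.
Proof.
move=> l0 [a [b [s [tC [wa] wb]]]] [c [d [s2 [tD wc wd]]]].
have sa : size a = n by apply: (level_cycle_size tC); rewrite !inE eqxx.
have sb : size b = n by apply: (level_cycle_size tC); rewrite !inE eqxx orbT.
have sc : size c = n by apply: (level_cycle_size tD); rewrite !inE eqxx.
have sd : size d = n by apply: (level_cycle_size tD); rewrite !inE eqxx orbT.
have hcd : hdist c d = 2.
  have [_ _ /=/andP[+ _]] := tD; rewrite /step => /orP[/eqP|/andP[/eqP//]].
  by move/(congr1 odd); rewrite odd_hdist ?sc ?sd // wc wd addbb.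
have hab : hdist a b = 1.
  have [_ _ /=/andP[+ _]] := tC; rewrite /step => /orP[/eqP//|/and3P[_]].
  by rewrite wa wb /=; case: (odd l).
have [z [sz wz hzb haz]] : exists z,
    [/\ size z = size a, wt z = wt a, hdist z b = 1 & hdist a z = 2].
  by apply: drop_other; rewrite ?wa ?wb ?sa ?sb.
(* Both [c d] and [a z] lie in level [l] at distance 2, so a coordinate permutation carries one to
   the other. *)
have [t {}tD] : exists t, tight n k l (odd l) [:: a, z & t].
  by apply: align_pair tD _ _ _ _ _; rewrite ?haz ?wz ?wa ?sz.
set p := odd l.+1 in tC *.
(* The cycle runs 1z, 0b, along the first cycle to 0a, then 1a and along the second cycle back to
   1z. The step 1z 0b has distance 2 inside level [l.+1]. *)
set C := [:: true :: z, false :: b & rcons (map (cons false) s) (false :: a)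
          ++ (true :: a) :: map (cons true) (rev t)].
have tE : tight n.+1 k.+1 l.+1 p C.
  apply: (tight_join tC); first by rewrite /p /= negbK; exact: tD.
    apply/permP => P; rewrite /C /= !count_cat -cats1 !count_cat /=.
    by rewrite !count_map count_rev; lia.
  have [_ _ /=/andP[_ cC]] := tC.
  have [_ _ /=/andP[_ cD]] := tight_swap tD.
  rewrite /C /= rcons_cat cat_path last_rcons /=.
  rewrite -[false :: a]/(false :: a) -!map_rcons.
  rewrite (path_map_cons _ _ (erefl (false (+) p))) /= cC.
  rewrite (@path_map_cons p (odd l)) ?cD; last by rewrite /p /= negbK.
  by rewrite /step !hdist_cons hdistxx hzb !wt_cons wz wa wb /p /= !eqxx.
split.
- exists (false :: a), (true :: a).
  exists (map (cons true) (rev t) ++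
          [:: true :: z, false :: b & map (cons false) s]).
  rewrite !wt_cons wa; split=> //.
  rewrite /C cat_rcons in tE.
  exact: (@level_cycle_catC _ _ _ _ [:: _, _ & map _ s] (_ :: _ :: _) tE).
- exists (true :: z), (false :: b); eexists.
  by rewrite !wt_cons wz wa wb; split=> //; exact: tE.
Qed.

(** An induction as in Pascal's triangle: dimension n+1 and level k+1 come from dimension n and
    levels k+1 and k. Row [k] starts in dimension 2k+e with a top edge only; the row below starts
    two dimensions earlier, so its top pair is already available. Row 0 is the Gray code. *)
Lemma glue_induction d e K : 0 < d <= e ->
    (forall k, 0 < k <= K -> top_edge (k.*2 + e) k (k + d)) ->
  forall n k, k <= K -> k.*2 + e <= n ->
    top_edge n k (k + d) /\ (k.*2 + e < n -> top_pair n k (k + d)).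
Proof.
move=> de base; elim=> [|n IH] k leK len; first by lia.
case: k leK len => [|k] leK len.
  by rewrite add0n; split=> [|lt]; [apply: top_edge_gray | apply: top_pair_gray]; lia.
case: (ltnP (k.+1.*2 + e) n.+1) => [lt|ge].
  have [E _] := IH k.+1 leK lt.
  have [_ T] := IH k (ltnW leK) ltac:(lia).
  have [||E' T'] := @glue_levels n k (k + d) _ E; [lia|apply: T; lia|].
  by [].
split; last by [].
by have <- : k.+1.*2 + e = n.+1 by [lia]; apply: base.
Qed.

(** The successor of a top-level word cannot be higher, and its weight has the other parity. *)
Lemma adj_top_edge n k l C : k < l <= n -> level_cycle adj n k l C ->
  exists a b s, [/\ level_cycle adj n k l [:: a, b & s], (wt a).+1 = l & wt b = l].
Proof.
case/andP=> ltkl leln hC.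
have bC : low_word n l \in C.
  case: hC => _ -> _; rewrite low_word_wt low_word_size // eqxx leqnn /=.
  by rewrite ltnW.
move: bC (low_word_wt n l) (low_word_size leln) hC => {ltkl leln}.
move: (low_word n l) => b /splitPr[s1 s2] wb sb /level_cycle_catC/=.
case: (s2 ++ s1) => [|a s] hC; first by case: hC => _ _; rewrite /= /adj /= hdistxx.
have aC : a \in [:: b, a & s] by rewrite !inE eqxx orbT.
have sa := level_cycle_size hC aC.
exists a, b, (rev s); split=> //.
  exact: level_cycle_swap adj_sym hC.
have [_ M /=/andP[/eqP hba _]] := hC; move: aC; rewrite M => /and3P[_ _ leal].
have := hdist_wt (etrans sb (esym sa)); rewrite hba wb.
have := odd_hdist (etrans sb (esym sa)); rewrite hba wb /= => o le.
have : wt a <> l by move=> e; rewrite e addbb in o.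
by move: (wt a) le leal; lia.
Qed.

(* The ends of the top pair of the lower cycle have a common upper neighbour
   [c], and the cycles are joined at an edge [c d] of the upper one. *)
Lemma stack_levels n k l C : 0 < l -> l.+2 <= n -> k <= l ->
    top_pair n k l -> level_cycle adj n l.+1 l.+2 C ->
  top_edge n k l.+2.
Proof.
move=> l0 ln kl [a [a' [s1 [tA wa wa']]]] hC.
have [|c [d [s2 [{}hC [wc] wd]]]] := adj_top_edge _ hC; first by rewrite ltnSn.
have sc : size c = n by apply: (level_cycle_size hC); rewrite !inE eqxx.
have sd : size d = n by apply: (level_cycle_size hC); rewrite !inE eqxx orbT.
have [UC MC /=/andP[/eqP hcd cC]] := hC.
(* The edge [c d] will be cut, so the new top edge has to be the other edge [d e] at [d]. It exists,
   as [d] has two lower neighbours, which cannot both be [c]. *)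
have [e [s2' Es2]] : exists e s2', s2 = e :: s2'.
  case: s2 hC UC MC cC => [|e s2'] _ _ MC _; last by exists e, s2'.
  have [|y [z [sy sz wy wz [_ _ hyz]]]] := @drop_two d; first by rewrite wd.
  have eqc x : size x = size d -> (wt x).+1 = wt d -> x = c.
    move=> sx wx; have : x \in [:: c; d].
      by rewrite MC sx sd eqxx /=; move: (wt x) wx; rewrite wd; lia.
    by rewrite !inE => /orP[/eqP//|/eqP exd]; rewrite exd in wx; lia.
  by rewrite (eqc y sy wy) (eqc z sz wz) hdistxx in hyz.
subst s2; move: cC => /=/andP[/eqP hde cC].
have eC : e \in [:: c, d, e & s2'] by rewrite !inE eqxx !orbT.
have se := level_cycle_size hC eC.
have we : (wt e).+1 = l.+2.
  move: eC; rewrite MC => /and3P[_ _ le].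
  have := hdist_wt (etrans sd (esym se)); rewrite hde wd.
  have := odd_hdist (etrans sd (esym se)); rewrite hde wd /= => o ge.
  have : wt e <> l.+2 by move=> ee; move: o; rewrite ee /=; case: (odd l).
  by move: (wt e) le ge; lia.
have [|y [z [sy sz [wy] [wz] [hyc hzc hyz]]]] := @drop_two c; first by rewrite wc; lia.
have sa : size a = n by apply: (level_cycle_size tA); rewrite !inE eqxx.
have sa' : size a' = n by apply: (level_cycle_size tA); rewrite !inE eqxx orbT.
have haa' : hdist a a' = 2.
  have [_ _ /=/andP[+ _]] := tA; rewrite /step => /orP[/eqP|/andP[/eqP//]].
  by move/(congr1 odd); rewrite odd_hdist ?sa ?sa' // wa wa' addbb.
rewrite wc in wy wz; case: wy wz => wy [wz].
have [t tY] : exists t, tight n k l (odd l) [:: y, z & t].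
  by apply: align_pair tA _ _ _ _ _; rewrite ?haa' ?wa ?wa' ?sy ?sz.
have hzd : hdist z d = 2.
  have le := hdist_triangle sz (etrans sc (esym sd)).
  have ge := hdist_wt (etrans sd (esym (etrans sz sc))).
  have := odd_hdist (etrans sz (etrans sc (esym sd))).
  move: le ge; rewrite hzc hcd [hdist d z]hdist_sym wd wz => le ge.
  by lia.
(* The cut steps [c d] and [y z] are replaced by the edge [c y] and the step [z d], which joins
   levels [l] and [l.+2] of equal parity. *)
set C' := [:: d, e & rcons s2' c ++ y :: rcons (rev t) z].
have pC' : perm_eq C' ([:: c, d, e & s2'] ++ [:: y, z & t]).
  apply/permP => P; rewrite /C' /= !count_cat -!cats1 /= !count_cat count_rev /=.
  by lia.
have [UY MY _] := tY.
have tC' : tight n k l.+2 (odd l.+2) C'.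
  split.
  - rewrite (perm_uniq pC') cat_uniq UC UY andbT; apply/hasPn => x.
    rewrite MY => /and3P[_ _ le]; apply/negP => xC.
    by have : x \in [:: c, d, e & s2'] := xC; rewrite MC ltnNge le andbF.
  - move=> x; rewrite (perm_mem pC') mem_cat MC MY; case: eqP => //= _.
    by move: (wt x); lia.
  - have [_ _ /=/andP[_ cY]] := tight_swap tY.
    have cC' : path (step (odd l.+2)) e (rcons s2' c).
      by apply: sub_path cC => u v uv; apply/orP; left.
    rewrite /C' /= rcons_cat cat_path cC' last_rcons /= rcons_path last_rcons.
    rewrite negbK cY /step hde hdist_sym hyc hzd wz wd /= negbK !eqxx.
    by [].
exists e, d; eexists; split=> //; exact: tight_swap tC'.
Qed.

(** * Paths in the middle levels *)

(** Plane trees in first-child, next-sibling form: [Node u v] has [u] below its first edge and [v]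
    as the remaining edges at the root. *)
Inductive tree := Leaf | Node of tree & tree.

Fixpoint dyck t : word :=
  if t is Node u v then true :: dyck u ++ false :: dyck v else [::].

Fixpoint edges t : nat := if t is Node u v then (edges u + edges v).+1 else 0.

Fixpoint tcat t s : tree := if t is Node u v then Node u (tcat v s) else s.

(** Moves the root along its first edge. *)
Definition rotate t : tree := if t is Node u v then tcat u (Node v Leaf) else Leaf.

(** A stack machine reading from the right: 0 pushes an empty tree, 1 joins the two topmost
    trees. *)
Fixpoint parse (w : word) : seq tree :=
  match w with
  | [::] => [::]
  | false :: w' => Leaf :: parse w'
  | true :: w' => if parse w' is u :: v :: s then Node u v :: s else [::]
  end.

Lemma parse_dyck t w : parse (dyck t ++ false :: w) = t :: parse w.
Proof. by elim: t w => //= u IHu v IHv w; rewrite -catA /= IHu IHv. Qed.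

Lemma dyck_inj : injective dyck.
Proof.
by move=> t s e; have := parse_dyck t [::]; rewrite e parse_dyck => -[].
Qed.

Definition tree_of (w : word) : option tree := ohead (parse (rcons w false)).

Lemma dyckK : pcancel dyck tree_of.
Proof. by move=> t; rewrite /tree_of -cats1 parse_dyck. Qed.

HB.instance Definition _ := Countable.copy tree (pcan_type dyckK).

Lemma dyck_size t : size (dyck t) = (edges t).*2.
Proof. by elim: t => //= u IHu v IHv; rewrite size_cat /= IHu IHv; lia. Qed.

Lemma dyck_wt t : wt (dyck t) = edges t.
Proof.
by elim: t => //= u IHu v IHv; rewrite wt_cons wt_cat wt_cons IHu IHv; lia.
Qed.

Lemma dyck_tcat t s : dyck (tcat t s) = dyck t ++ dyck s.
Proof. by elim: t => //= u _ v ->; rewrite -catA. Qed.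

Lemma edges_tcat t s : edges (tcat t s) = edges t + edges s.
Proof. by elim: t => //= u _ v ->; lia. Qed.

Lemma edges_rotate t : edges (rotate t) = edges t.
Proof. by case: t => //= u v; rewrite edges_tcat /=; lia. Qed.

Lemma cat_eq_cat (T : Type) (s1 s2 t1 t2 : seq T) : s1 ++ s2 = t1 ++ t2 ->
  (exists r, s1 = t1 ++ r /\ t2 = r ++ s2) \/ (exists r, t1 = s1 ++ r /\ s2 = r ++ t2).
Proof.
elim: s1 t1 => [|x s1 IH] [|y t1] /= e; first by left; exists [::].
- by right; exists (y :: t1).
- by left; exists (x :: s1).
- by case: e => -> /IH[] [r [-> ->]]; [left|right]; exists r.
Qed.

Lemma dyck_prefix t a b : dyck t = a ++ b -> size a <= (wt a).*2.
Proof.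
elim: t a b => [|u IHu v IHv] [|x a] b //= [<-]; rewrite wt_cons.
case/cat_eq_cat => -[r [e]]; first by have := IHu _ _ e; lia.
case: r e => [|y r] -> [_]; first by rewrite cats0 dyck_size dyck_wt; lia.
by rewrite size_cat wt_cat wt_cons dyck_size dyck_wt => /IHv/=; lia.
Qed.

Lemma dyck_suffix t a b : dyck t = a ++ b -> (wt b).*2 <= size b.
Proof.
move=> e; have := dyck_prefix e; have := dyck_size t.
by rewrite -dyck_wt e size_cat wt_cat; lia.
Qed.

Lemma dyck_dn_inj u v a b :
  dyck u ++ false :: a = dyck v ++ false :: b -> u = v /\ a = b.
Proof.
move=> e; have := parse_dyck u a; rewrite e parse_dyck => -[uv _].
by move: e; rewrite uv => /eqP; rewrite eqseq_cat // eqxx /= => /eqP[].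
Qed.

Lemma dyck_neq_up t a v : dyck t <> a ++ true :: dyck v.
Proof.
by move/dyck_suffix; rewrite wt_cons dyck_wt /= dyck_size; lia.
Qed.

Lemma dyck_neq_dn t u b : dyck t <> dyck u ++ false :: b.
Proof.
rewrite -cat1s catA => /dyck_prefix.
by rewrite size_cat wt_cat dyck_wt dyck_size /=; rewrite /wt /=; lia.
Qed.

Lemma dyck_up_inj u v a b :
  a ++ true :: dyck u = b ++ true :: dyck v -> u = v /\ a = b.
Proof.
case/cat_eq_cat => -[[|x r]] [->] e; rewrite ?cats0.
- by case: e => /dyck_inj ->.
- by case: e => _ /dyck_neq_up.
- by case: e => /dyck_inj ->.
- by case: e => _ /dyck_neq_up.
Qed.

(** The cut is at the first 0 without a matching 1; the induction strips a leading 1 together with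
    its matching 0. *)
Lemma split_dn z : (wt z).*2 <= size z ->
  (exists t, z = dyck t) \/ (exists u b, z = dyck u ++ false :: b).
Proof.
have [n] := ubnP (size z); elim: n z => // n IH [|[] z] /= lt le.
- by left; exists Leaf.
- rewrite wt_cons in le.
  case: (IH z) => [|||[u [b ez]]]; [lia|lia| |].
    by case=> t ez; rewrite ez dyck_wt dyck_size in le; lia.
  rewrite ez size_cat wt_cat wt_cons dyck_wt dyck_size /= in le lt.
  case: (IH b) => [||[v eb]|[v [b' eb]]]; [lia|lia| |].
    by left; exists (Node u v); rewrite ez eb.
  by right; exists (Node u v), b'; rewrite ez eb /= -catA.
- by right; exists Leaf, z.
Qed.

(** The mirror image of [split_dn], read from the right. *)
Lemma split_up z : size z <= (wt z).*2 ->
  (exists t, z = dyck t) \/ (exists a v, z = a ++ true :: dyck v).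
Proof.
have [n] := ubnP (size z); elim: n z => // n IH z.
case/lastP: z => [|z []]; first by left; exists Leaf.
- by move=> *; right; exists z, Leaf; rewrite cats1.
rewrite size_rcons -cats1 wt_cat => lt le.
case: (IH z) => [|||[a [v ez]]]; [lia|by rewrite /wt /= in le *; lia| |].
  by case=> t ez; rewrite ez dyck_wt dyck_size /wt /= in le; lia.
rewrite ez size_cat wt_cat wt_cons dyck_wt /= dyck_size /wt /= in le lt.
rewrite -!/(wt _) in le.
case: (IH a) => [||[u ea]|[a' [u ea]]]; [lia|lia| |].
  by left; exists (tcat u (Node v Leaf)); rewrite ez ea dyck_tcat -catA.
by right; exists a', (tcat u (Node v Leaf)); rewrite ez ea dyck_tcat /= -!catA.
Qed.

(** The path of [t = 1u0v] runs 1t, 0t, then 0a1v from [a = 1u] to [a = u0], then 1u0b from [b = 1v]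
    to [b = v0]; where pieces meet, one bit changes. The last word t0 is kept apart, since exchanges
    act on the bodies only. *)
Fixpoint sbody t : seq word :=
  if t is Node u v then
    [:: true :: dyck t, false :: dyck t &
      map (fun a => false :: a ++ true :: dyck v) (rcons (sbody u) (rcons (dyck u) false))
      ++ map (fun b => true :: dyck u ++ false :: b) (sbody v)]
  else [:: [:: true]].

Definition spath t : seq word := rcons (sbody t) (rcons (dyck t) false).

Lemma spath_Node u v : spath (Node u v) =
  [:: true :: dyck (Node u v), false :: dyck (Node u v) &
    map (fun a => false :: a ++ true :: dyck v) (spath u)
    ++ map (fun b => true :: dyck u ++ false :: b) (spath v)].
Proof. by rewrite /spath [map _ (rcons (sbody v) _)]map_rcons /= !rcons_cat. Qed.

Lemma spath_NodeP u v w : w \in spath (Node u v) ->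
  [\/ w = true :: dyck (Node u v), w = false :: dyck (Node u v),
      exists2 a, a \in spath u & w = false :: a ++ true :: dyck v
    | exists2 b, b \in spath v & w = true :: dyck u ++ false :: b].
Proof.
rewrite spath_Node !inE mem_cat => /or4P[/eqP->|/eqP->|/mapP[a]|/mapP[b]] *.
- by constructor 1.
- by constructor 2.
- by constructor 3; exists a.
- by constructor 4; exists b.
Qed.

Lemma spath_level t w : w \in spath t ->
  size w = (edges t).*2.+1 /\ edges t <= wt w <= (edges t).+1.
Proof.
elim: t w => [|u IHu v IHv] w.
  by rewrite !inE => /orP[] /eqP->.
case/spath_NodeP => [->|->|[a /IHu[sa wa] ->]|[b /IHv[sb wb] ->]];
  rewrite !wt_cons ?wt_cat ?wt_cons ?dyck_wt /= ?size_cat /= ?dyck_size;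
  split; rewrite ?sa ?sb; lia.
Qed.

Lemma adjE x y : adj x y = (hdist x y == 1).
Proof. by []. Qed.

Lemma spath_path t : exists s,
  [/\ spath t = (true :: dyck t) :: s, path adj (true :: dyck t) s
    & last (true :: dyck t) s = rcons (dyck t) false].
Proof.
elim: t => [|u [su [eu pu lu]] v [sv [ev pv lv]]]; first by exists [:: [:: false]].
rewrite spath_Node; eexists; split; first reflexivity; last first.
  rewrite /= last_cat ev /= (last_map _ _ (true :: dyck v)) lv.
  by rewrite rcons_cat.
rewrite /= eu ev cat_path /=.
rewrite (last_map (fun a => false :: a ++ true :: dyck v) _ (true :: dyck u)) lu.
rewrite /= !adjE !hdist_cons hdistxx hdist_catl !hdist_cons hdistxx -cats1 -catA.
rewrite hdistxx /= path_map; apply/andP; split; last first.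
  by apply: sub_path pv => a b; rewrite /= !adjE hdist_cons hdist_catl hdist_cons.
pose f a := false :: a ++ true :: dyck v.
suff : path adj (f (true :: dyck u)) (map f su) by [].
rewrite path_map; apply: (@sub_in_path _ [pred a | size a == (edges u).*2.+1]) pu.
  by move=> a b /eqP sa /eqP sb; rewrite /= !adjE hdist_cons hdist_catr // sa sb.
by rewrite -eu; apply/allP => a /spath_level[sa _]; rewrite inE sa.
Qed.

(** After the first letter, the rest is cut by [split_dn] or [split_up]. A Dyck rest gives one of
    the first two words of a path; a cut gives a word from the path of a smaller tree. *)
Lemma spath_cover m w : size w = m.*2.+1 -> m <= wt w <= m.+1 ->
  exists t, edges t = m /\ w \in spath t.
Proof.
have [n] := ubnP m; elim: n m w => // n IH m [//|[] z] lt /= [sz] /andP[w1 w2].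
- rewrite wt_cons in w1 w2.
  case: (@split_dn z) => [|[t ez]|[u [b ez]]]; first by lia.
    exists t; split; first by rewrite ez dyck_size in sz; lia.
    by rewrite ez; have [s [-> _ _]] := spath_path t; rewrite mem_head.
  rewrite ez size_cat wt_cat wt_cons dyck_wt /= dyck_size in sz w1 w2.
  case: (IH (m - (edges u).+1) b) => [|||v [ev bv]]; [lia|lia|lia|].
  exists (Node u v); rewrite /= ev; split; first by lia.
  rewrite spath_Node ez !inE mem_cat; apply/or4P; constructor 4.
  by apply/mapP; exists b.
- rewrite wt_cons in w1 w2.
  case: (@split_up z) => [|[t ez]|[a [v ez]]]; first by lia.
    exists t; split; first by rewrite ez dyck_size in sz; lia.
    rewrite ez; case: t {ez} => [|u v]; first by rewrite !inE.
    by rewrite spath_Node !inE eqxx orbT.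
  rewrite ez size_cat wt_cat wt_cons dyck_wt /= dyck_size in sz w1 w2.
  case: (IH (m - (edges v).+1) a) => [|||u [eu au]]; [lia|lia|lia|].
  exists (Node u v); rewrite /= eu; split; first by lia.
  rewrite spath_Node ez !inE mem_cat; apply/or4P; constructor 3.
  by apply/mapP; exists a.
Qed.

(** The four forms in [spath_NodeP] exclude each other by the first letter and by whether the rest
    is a Dyck word; within a form the cut is unique. *)
Lemma spath_disjoint t s w : w \in spath t -> w \in spath s -> t = s.
Proof.
elim: t s w => [|u IHu v IHv] s w wt ws.
  have [_ /andP[le1 le2]] := spath_level wt.
  have [sw _] := spath_level ws; have [sw' _] := spath_level wt.
  by case: s ws sw => //= s1 s2 _; rewrite sw' /=; lia.
case: s ws => [|u' v'] ws.
  have [sw _] := spath_level ws; have [sw' _] := spath_level wt.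
  by rewrite sw /= in sw'; lia.
case/spath_NodeP: wt ws => [->|->|[a au ->]|[b bv ->]] /spath_NodeP[].
- by move/(congr1 behead)/dyck_inj.
- by [].
- by case.
- by case=> b _ /(congr1 behead)/(@dyck_neq_dn (Node u v)).
- by [].
- by move/(congr1 behead)/dyck_inj.
- by case=> a _ /(congr1 behead)/(@dyck_neq_up (Node u v)).
- by case.
- by [].
- by move/(congr1 behead)/esym/(@dyck_neq_up (Node u' v')).
- by case=> a' au' [] /dyck_up_inj[ev ea]; rewrite ev (IHu u' a) // ea.
- by case.
- by move/(congr1 behead)/esym/(@dyck_neq_dn (Node u' v')).
- by [].
- by case.
- by case=> b' bv' [] /dyck_dn_inj[eu eb]; rewrite eu (IHv v' b) // eb.
Qed.

Lemma spath_uniq t : uniq (spath t).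
Proof.
elim: t => // u IHu v IHv; rewrite spath_Node /= mem_cat !inE.
rewrite cat_uniq !map_inj_in_uniq ?IHu ?IHv /=; first last.
- by move=> a b _ _ [] /dyck_up_inj[].
- by move=> a b _ _ [] /dyck_dn_inj[].
rewrite mem_cat !negb_or andbT; apply/and3P; split.
- by apply/andP; split; apply/mapP => -[a _] // /(congr1 behead)/(@dyck_neq_dn (Node u v)).
- by apply/andP; split; apply/mapP => -[a _] // /(congr1 behead)/(@dyck_neq_up (Node u v)).
- by apply/hasPn => _ /mapP[b _ ->]; apply/mapP => -[a _].
Qed.

(** Exchanges 110u0v and 101u0v: a pendant edge slides along the first edge that follows it. *)
Definition pull t : tree :=
  match t with
  | Node (Node Leaf u) v => Node Leaf (Node u v)
  | Node Leaf (Node u v) => Node (Node Leaf u) v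
  | _ => t
  end.

Lemma pullK : involutive pull.
Proof. by case=> [|[|[|u1 u2] u] [|v1 v2]]. Qed.

Lemma edges_pull t : edges (pull t) = edges t.
Proof. by case: t => [|[|[|u1 u2] u] [|v1 v2]] //=; lia. Qed.

(* A pendant edge at the root can be moved around the tree by [rotate] and
   [pull], so a plane tree with a pendant edge attached behaves, up to these
   moves, like the tree without it. *)
Lemma tree_connected m (e : tree -> tree -> Prop) :
    (forall t, e t t) -> (forall t s, e t s -> e s t) ->
    (forall t s r, e t s -> e s r -> e t r) ->
    (forall t, edges t = m -> e t (rotate t)) ->
    (forall t, edges t = m -> e t (pull t)) ->
  forall t s, edges t = m -> edges s = m -> e t s.
Proof.
elim: m e => [|m IH] e eR eS eT eRot ePull t s et es.
  by case: t s et es => [|? ?] [|? ?].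
(* Rotation descends into the first subtree until that is empty. *)
have pendant r : edges r = m.+1 -> exists2 r', edges r' = m & e r (Node Leaf r').
  case: r => // u v; elim: u v => [|u1 IHu u2 _] v er.
    by exists v; [case: er|exact: eR].
  have [|r' er' e'] := IHu (tcat u2 (Node v Leaf)).
    by rewrite -er /= edges_tcat /=; lia.
  by exists r' => //; exact: (eT _ _ _ (eRot _ er) e').
have [[t' et' tt'] [s' es' ss']] := (pendant t et, pendant s es).
apply: (eT _ _ _ tt' (eT _ _ _ _ (eS _ _ ss'))) => {t s et es tt' ss'}.
have around r : edges r = m -> e (Node Leaf r) (tcat r (Node Leaf Leaf)).
  move=> er; apply: (eT _ (Node r Leaf)); first by apply: eRot; rewrite /= er.
  by apply: (eRot (Node r Leaf)); rewrite /= er addn0.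
apply: (IH (fun a b => e (Node Leaf a) (Node Leaf b))) => //.
- by move=> a b; exact: eS.
- by move=> a b c; exact: eT.
(* Pulling moves the pendant edge into the first subtree; rotating then brings it back to the front
   of the rotated rest. *)
- case=> [|u v] er; first exact: eR.
  apply: (eT _ _ _ (ePull (Node Leaf (Node u v)) _)); first by move: er => /=; lia.
  by apply: (eRot (Node (Node Leaf u) v)); rewrite -er /=; lia.
(* With the pendant edge moved to the end, [pull] can act on the front. *)
- move=> r er; apply: (eT _ _ _ (around _ er)).
  apply: (eT _ _ _ _ (eS _ _ (around _ _))); last by rewrite edges_pull.
  have : edges (tcat r (Node Leaf Leaf)) = m.+1 by rewrite edges_tcat er addn1.
  move/ePull; case: r er => [|[|[|u1 u2] u] [|v1 v2]] //= *; exact: eR.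
Qed.

Definition mtree m := {t : tree | edges t == m}.

Lemma mtree_size m (t : mtree m) : size (dyck (val t)) == m.*2.
Proof. by rewrite dyck_size (eqP (valP t)). Qed.

Lemma mtree_pcan m : pcancel (fun t : mtree m => Tuple (mtree_size t))
  (fun w => obind insub (tree_of w)).
Proof. by move=> t; rewrite /= dyckK /= valK. Qed.

HB.instance Definition _ m := [Countable of mtree m by <:].
HB.instance Definition _ m : isFinite (mtree m) := PCanIsFinite (@mtree_pcan m).

(** * Merging the cycles of a permutation *)

(** Since [x] and [y] lie on different cycles of [g], the map [g'] follows each old cycle from its
    second point all the way round, and then crosses to the other one. *)
Lemma fconnect_exchange (T : finType) (g g' : T -> T) x y :
    injective g -> injective g' -> ~~ fconnect g x y ->
    g' x = g y -> g' y = g x -> (forall z, z != x -> z != y -> g' z = g z) ->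
  fconnect g' x y /\ (forall a b, fconnect g a b -> fconnect g' a b).
Proof.
move=> inj inj' nxy gx gy gz.
have back u v : ~~ fconnect g u v -> (forall z, z != u -> z != v -> g' z = g z) ->
    fconnect g' (g u) u.
  move=> nuv guv.
  have ex : exists n, iter n g (g u) == u.
    (* The first return to [u] meets neither [u] earlier nor [v], so [g'] agrees with [g] on the
       way. *)
    have : fconnect g (g u) u by rewrite (fconnect_sym inj) fconnect1.
    by move/iter_findex => e; exists (findex g (g u) u); rewrite e.
  case: (ex_minnP ex) => n /eqP en min.
  suff H i : i <= n -> iter i g' (g u) = iter i g (g u).
    by rewrite -{2}en -H // fconnect_iter.
  elim: i => //= i IH lt; rewrite IH ?(ltnW lt) //; apply: guv.
    by apply/negP => /min; rewrite leqNgt lt.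
  apply: contraNneq nuv => <-; rewrite -iterSr; exact: fconnect_iter.
have nyx : ~~ fconnect g y x by rewrite (fconnect_sym inj).
have bx := back x y nxy gz.
have by' : fconnect g' (g y) y by apply: back nyx _ => z zy zx; exact: gz.
have xy : fconnect g' x y by apply: connect_trans by'; rewrite -gx fconnect1.
split=> // a b.
have step z : fconnect g' z (g z).
  case: (eqVneq z x) => [->|zx].
    by apply: connect_trans xy _; rewrite -gy fconnect1.
  case: (eqVneq z y) => [->|zy]; last by rewrite -gz // fconnect1.
  by rewrite -gx; apply: (@connect_trans _ _ x); rewrite ?fconnect1 // (fconnect_sym inj').
case/iter_findex; move: (findex _ _ _) => n <-.
elim: n => //= n IH; exact: connect_trans IH (step _).
Qed.

Section Twist.

Variables (T : finType) (f psi : T -> T).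
Hypotheses (f_inj : injective f) (psiK : involutive psi).

Definition swap_on (A : {set T}) x := if x \in A then psi x else x.

Definition stable (A : {set T}) := forall x, (psi x \in A) = (x \in A).

Lemma swap_onK A : stable A -> involutive (swap_on A).
Proof.
by move=> sA x; rewrite /swap_on; case xA: (x \in A); rewrite ?sA xA ?psiK.
Qed.

Lemma twist_inj A : stable A -> injective (f \o swap_on A).
Proof. by move=> sA; apply: inj_comp f_inj (inv_inj (swap_onK sA)). Qed.

(* A maximal set of exchanges each of which merges two cycles of the
   permutation. *)
Lemma twist_connected :
    (forall e : rel T, (forall x, e x x) -> symmetric e -> transitive e ->
       (forall x, e x (f x)) -> (forall x, e x (psi x)) -> forall x y, e x y) ->
  exists2 A, stable A & forall x y, fconnect (f \o swap_on A) x y.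
Proof.
move=> total; pose g A := f \o swap_on A.
(* Admissible sets split no cycle of [f], and each of their pairs already lies on one cycle. *)
pose ok (A : {set T}) := [&& [forall x, (psi x \in A) == (x \in A)],
  [forall x, fconnect (g A) x (f x)] & [forall x in A, fconnect (g A) x (psi x)]].
have ok0 : ok set0.
  apply/and3P; split; apply/forallP => x; rewrite ?inE //.
  by have -> : f x = g set0 x by [rewrite /g /= /swap_on inE]; exact: fconnect1.
case: (@arg_maxnP _ set0 ok (fun A => #|A|) ok0) => A.
case/and3P=> [/forallP sA /forallP Af /forall_inP Apsi] max.
have {}sA : stable A by move=> x; apply/eqP.
have gA_inj : injective (g A) := twist_inj sA.
exists A => //; apply: total => [x||||x].
- exact: connect0.
- exact: fconnect_sym.
- exact: connect_trans.
- exact: Af.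
apply/negPn/negP => nx.
have xA : x \notin A by apply: contra nx => /Apsi.
pose A' := x |: (psi x |: A).
have sA' : stable A'.
  move=> z; rewrite !inE sA (inj_eq (inv_inj psiK)) -{1}[x]psiK (inj_eq (inv_inj psiK)).
  by rewrite orbCA.
have [|||xpx sub] := @fconnect_exchange _ (g A) (g A') x (psi x) gA_inj (twist_inj sA') nx.
- by rewrite /g /= /swap_on !inE eqxx sA (negbTE xA).
- by rewrite /g /= /swap_on !inE eqxx orbT psiK (negbTE xA).
- by move=> z zx zpx; rewrite /g /= /swap_on !inE (negbTE zx) (negbTE zpx).
have : #|A'| <= #|A|.
  apply: max; apply/and3P; split; apply/forallP => z; first by apply/eqP; exact: sA'.
    exact/sub/Af.
  apply/implyP; rewrite !inE => /or3P[/eqP->|/eqP->|zA]; first exact: xpx.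
    by rewrite psiK (fconnect_sym (twist_inj sA')).
  exact/sub/Apsi.
apply/negP; rewrite -ltnNge; apply: proper_card; rewrite properE; apply/andP; split.
  by apply/subsetP => z zA; rewrite !inE zA !orbT.
by apply/subsetPn; exists x; rewrite ?inE ?eqxx.
Qed.

End Twist.

Lemma cycle_flatten (T : finType) (S : eqType) (e : rel S) (g : T -> T)
    (st : T -> S) (tl : T -> seq S) z s :
    fcycle g (z :: s) ->
    (forall x, path e (st x) (tl x)) ->
    (forall x, e (last (st x) (tl x)) (st (g x))) ->
  cycle e (flatten [seq st x :: tl x | x <- z :: s]).
Proof.
move=> + p l; rewrite /cycle /= !rcons_path cat_path p last_cat /=.
(* The closing point becomes a separate [z0], so that the induction may move the first point. *)
move: {3 8}z => z0;  
 elim: s z => [|y s IH] z /=.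
  by move/eqP <-; exact: l.
rewrite cat_path p last_cat -!andbA => /andP[/eqP <- /IH].
by rewrite l.
Qed.

(** * The middle levels theorem *)

Lemma rotate_inj : injective rotate.
Proof.
move=> t s e; have := congr1 edges e; rewrite !edges_rotate.
case: t s e => [|u v] [|u' v'] //= /(congr1 dyck).
rewrite !dyck_tcat /= -!cat_cons !catA !cats1 => /rcons_inj[].
by case/dyck_up_inj => -> /dyck_inj->.
Qed.

Lemma rotate_adj u v : adj (rcons (dyck (Node u v)) false) (true :: dyck (rotate (Node u v))).
Proof.
rewrite adjE dyck_tcat /= hdist_cons rcons_cat hdist_catl /= -cats1.
by rewrite hdist_cons hdistxx.
Qed.

Lemma sbody_path t : exists s,
  [/\ sbody t = (true :: dyck t) :: s, path adj (true :: dyck t) s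
    & adj (last (true :: dyck t) s) (rcons (dyck t) false)].
Proof.
have [s [es ps _]] := spath_path t.
have [r er] : exists r, sbody t = (true :: dyck t) :: r by case: (t); eexists.
by exists r; move: es ps; rewrite /spath er /= => -[<-]; rewrite rcons_path => /andP[].
Qed.

Definition pendant_first t := if t is Node Leaf (Node _ _) then true else false.

(* For [t = 101u0v] and [q = u1v0] the body of [rotate (pull t) = 10q] begins
   with 110q, 010q, 011q, 001q, 101q, 100q; reversing the first five words
   exchanges the edges of a 6-cycle. *)
Definition switch (L : seq word) := rev (take 5 L) ++ drop 5 L.

(** For [t = 110u0v] the words are 110u0v0 and 111u0v0; the other trees considered are fixed by
    [pull]. *)
Lemma pull_adj t : 0 < edges t -> ~~ pendant_first t ->
  adj (rcons (dyck t) false) (true :: dyck (rotate (pull t))).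
Proof.
case: t => [|[|[|w u] t'] v] // _.
- by case: v => // _; exact: (rotate_adj Leaf Leaf).
- by rewrite adjE /= -cats1 -!catA /= !hdist_cons hdistxx.
- by move=> _; exact: rotate_adj.
Qed.

Lemma switch_path u v (t := Node Leaf (Node u v)) (L := sbody (rotate (pull t))) x :
  path adj (rcons (dyck t) false) (switch L) /\ last x (switch L) = last x L.
Proof.
have [r eq] : exists r, sbody (tcat u (Node v Leaf)) =
    [:: true :: dyck (tcat u (Node v Leaf)), false :: dyck (tcat u (Node v Leaf)) & r].
  by case: (u) => [|u1 u2]; eexists.
have := sbody_path (Node Leaf (tcat u (Node v Leaf))).
case=> s [es ps _]; have -> : L = sbody (Node Leaf (tcat u (Node v Leaf))) by [].
move: es ps; rewrite /= eq => -[<-] /= /and5P[a1 a2 a3 a4 /andP[a5 pr]].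
split; last by [].
apply/and5P; split; rewrite 1?adj_sym //; last first.
  by rewrite a1 pr adjE !hdist_cons hdistxx.
(* The word t0 = 101u0v0 is adjacent to the fifth word 101u1v0. *)
by rewrite adjE dyck_tcat /= rcons_cat /= -cats1 !hdist_cons hdist_catl hdist_cons hdistxx.
Qed.

Section MiddleLevels.

Variable m : nat.

Definition mrotate (t : mtree m.+1) : mtree m.+1.
Proof. by exists (rotate (val t)); rewrite edges_rotate; exact: (valP t). Defined.

Definition mpull (t : mtree m.+1) : mtree m.+1.
Proof. by exists (pull (val t)); rewrite edges_pull; exact: (valP t). Defined.

Lemma mrotate_inj : injective mrotate.
Proof. by move=> t s /(congr1 val)/rotate_inj/val_inj. Qed.

Lemma mpullK : involutive mpull.
Proof. by move=> t; apply/val_inj/pullK. Qed.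

Lemma mtree_total (e : rel (mtree m.+1)) :
    (forall x, e x x) -> symmetric e -> transitive e ->
    (forall x, e x (mrotate x)) -> (forall x, e x (mpull x)) -> forall x y, e x y.
Proof.
move=> eR eS eT eRot ePull x y.
(* Equal edge numbers ensure that the middle tree in a transitivity step lies in [mtree m.+1]. *)
pose e' t s := edges t = edges s /\ forall x y : mtree m.+1, val x = t -> val y = s -> e x y.
have [] := @tree_connected m.+1 e' _ _ _ _ _ (val x) (val y).
- by move=> t; split=> // a b <- /val_inj->.
- by move=> t s [ets ts]; split=> // a b ea eb; rewrite eS; exact: ts.
- move=> t s r [ets ts] [esr sr]; split; first by rewrite ets.
  move=> a b ea eb; have es : edges s == m.+1.
    by rewrite -ets -ea; exact: (valP a).
  by apply: (eT (exist _ s es)); [exact: ts|exact: sr].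
- move=> t et; split; first by rewrite edges_rotate.
  by move=> a b ea eb; rewrite (_ : b = mrotate a) //; apply: val_inj; rewrite eb -ea.
- move=> t et; split; first by rewrite edges_pull.
  by move=> a b ea eb; rewrite (_ : b = mpull a) //; apply: val_inj; rewrite eb -ea.
- exact/eqP/(valP x).
- exact/eqP/(valP y).
by move=> _; exact.
Qed.

Variable A : {set mtree m.+1}.

Definition start (x : mtree m.+1) : word := rcons (dyck (val x)) false.

Definition next_tree := mrotate \o swap_on mpull A.

(** What follows the end word of the path of [x]. In an exchanged pair only the member 101u0v needs
    the switched body. *)
Definition tail (x : mtree m.+1) : seq word :=
  let L := sbody (val (next_tree x)) in
  if (x \in A) && pendant_first (val x) then switch L else L.

Lemma val_next_tree x :
  val (next_tree x) = rotate (if x \in A then pull (val x) else val x).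
Proof. by rewrite /next_tree /= /swap_on; case: ifP. Qed.

Lemma tail_path x :
  path adj (start x) (tail x) /\ adj (last (start x) (tail x)) (start (next_tree x)).
Proof.
have [s [es ps ls]] := sbody_path (val (next_tree x)).
rewrite /tail /start; case: ifP => [/andP[xA]|xN].
  rewrite val_next_tree xA in es ls *.
  case: (val x) es ls => [|[|[|w u] t'] [|u' v]] // es ls _.
  have [p l] := switch_path u' v (rcons (dyck (Node Leaf (Node u' v))) false).
  by split; [exact: p|rewrite l es].
rewrite es; split; last exact: ls.
apply/andP; split; last exact: ps.
rewrite val_next_tree.
have x0 : 0 < edges (val x) by rewrite (eqP (valP x)).
case: ifP xN => xA; first by move=> /negbT; exact: pull_adj.
by case: (val x) x0 => // u v _ _; exact: rotate_adj.
Qed.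

Lemma count_tail P x : count P (tail x) = count P (sbody (val (next_tree x))).
Proof.
rewrite /tail; case: ifP => // _; rewrite /switch count_cat count_rev.
by rewrite -count_cat cat_take_drop.
Qed.

End MiddleLevels.

Lemma uniq_flatten_spath s : uniq s -> uniq (flatten (map spath s)).
Proof.
elim: s => //= t s IH /andP[ts /IH us]; rewrite cat_uniq spath_uniq us andbT.
apply/hasPn => w /flattenP[_ /mapP[r rs ->] wr]; apply: contra ts => wt.
by rewrite (spath_disjoint wt wr).
Qed.

Lemma mtree_exists m : exists t, edges t = m.
Proof.
elim: m => [|m [t et]]; first by exists Leaf.
by exists (Node Leaf t); rewrite /= et.
Qed.

Lemma middle_levels m : 0 < m -> exists C, level_cycle adj m.*2.+1 m m.+1 C.
Proof.
case: m => // m _.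
have [A sA conn] := twist_connected (@mrotate_inj m) (@mpullK m) (@mtree_total m).
have g_inj : injective (next_tree A) := twist_inj (@mrotate_inj m) (@mpullK m) sA.
have [t0 /eqP et0] := mtree_exists m.+1.
pose z : mtree m.+1 := exist _ t0 et0.
pose O := orbit (next_tree A) z.
have pO : perm_eq O (index_enum (mtree m.+1)).
  apply: uniq_perm; rewrite ?orbit_uniq ?index_enum_uniq // => x.
  by rewrite mem_index_enum -fconnect_orbit conn.
pose C := flatten [seq start x :: tail A x | x <- O].
pose D := flatten (map spath (map val (index_enum (mtree m.+1)))).
have pC : perm_eq C D.
  apply/permP => P; rewrite /C /D !count_flatten !sumnE !big_map.
  rewrite (perm_big _ pO) /=.
  under eq_bigr do rewrite count_tail.
  (* Reindexing along the permutation [next_tree A] reunites each body with its own end word. *)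
  have R : \sum_x count P (sbody (val (next_tree A x)))
         = \sum_(x : mtree m.+1) count P (sbody (val x)).
    by rewrite [RHS](reindex_inj g_inj).
  rewrite big_split /= [X in _ + X]R.
  rewrite -big_split /=; apply: eq_bigr => x _.
  by rewrite /spath -cats1 count_cat /= addn0 addnC.
exists C; split.
- by rewrite (perm_uniq pC) uniq_flatten_spath // (map_inj_uniq val_inj);
    exact: index_enum_uniq.
- move=> w; rewrite (perm_mem pC); apply/flattenP/andP.
    case=> _ /mapP[_ /mapP[t _ ->] ->].
    by case/spath_level; rewrite (eqP (valP t)) => -> ->.
  case=> /eqP sw lw.
  have [t [/eqP et wt]] := spath_cover sw lw.
  exists (spath t) => //; apply: map_f; apply/mapP.
  exists (exist _ t et) => //; exact: (mem_index_enum (exist _ t et : mtree m.+1)).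
- have : fcycle (next_tree A) O by exact: cycle_orbit g_inj z.
  rewrite /C; case: (O) => // y s cO.
  apply: (@cycle_flatten _ _ adj (next_tree A) (@start m) (tail A)) => // x.
    by have [] := tail_path A x.
  by have [] := tail_path A x.
Qed.

(** * Tight enumerations *)

Lemma has_hamilton_level_cycle n k l : has_hamilton_cycle n k l ->
  exists C, level_cycle adj n k l C.
Proof.
case=> C [_ /andP[cC UC] MC]; exists (map val C); split.
- by rewrite (map_inj_uniq val_inj).
- move=> w; case: eqP => [sw|sw] /=; last first.
    by apply/mapP => -[x _ wx]; rewrite wx size_tuple in sw.
  have -> : w = val (Tuple (introT eqP sw)) by [].
  by rewrite (mem_map val_inj) MC inE.
- rewrite cycle_map; apply: sub_cycle cC => x y.
  by rewrite /cube_adj /= hamming_distE.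
Qed.

Lemma tight_compl n k l p C : k <= n -> l <= n ->
  tight n (n - l) (n - k) p C -> exists p' C', tight n k l p' C'.
Proof.
move=> lekn leln /tight_negb; rewrite !subKn ?leq_subr // => H.
by do 2!eexists; apply: H.
Qed.

Lemma middle_top_edge k : 0 < k -> top_edge (k.*2 + 1) k (k + 1).
Proof.
rewrite !addn1 => /middle_levels[C /adj_top_edge[|a [b [s [hC wa wb]]]]]; first by lia.
by exists a, b, s; split=> //; exact: adj_tight.
Qed.

(** For l = k+2j+1 the dimension is 2l-1, so l-1 and l are its middle levels. The levels [k,l-2]
    below come by gluing from the case j-1 for all smaller or equal [k]. *)
Lemma lower_half_top_edge j k : 0 < k ->
  top_edge (k.*2 + (j.*2.*2 + 1)) k (k + (j.*2 + 1)).
Proof.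
elim: j k => [|j IH] k k0; first exact: middle_top_edge.
have [C hC] := @middle_levels (k + (j.*2 + 1)).+1 isT.
have [_ T] := @glue_induction (j.*2 + 1) (j.*2.*2 + 1) k ltac:(lia)
  (fun i ik => IH i (proj1 (andP ik))) (k.*2 + (j.+1.*2.*2 + 1)) k (leqnn k) ltac:(lia).
have -> : k + (j.+1.*2 + 1) = (k + (j.*2 + 1)).+2 by lia.
apply: (@stack_levels _ _ _ C); [lia|lia|lia|apply: T; lia|].
by have <- : (k + (j.*2 + 1)).+1.*2.+1 = k.*2 + (j.+1.*2.*2 + 1) by lia.
Qed.

Lemma two_levels_tight n k : 0 < k -> k.*2 + 1 <= n ->
  exists C, tight n k (k + 1) (odd (k + 1)) C.
Proof.
move=> k0 len; apply: top_edge_tight.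
have base i : 0 < i <= k -> top_edge (i.*2 + 1) i (i + 1).
  by case/andP=> i0 _; exact: middle_top_edge.
by have [] := @glue_induction 1 1 k isT base n k (leqnn k) len.
Qed.

Lemma lower_half_tight n k l : 0 < k -> k < l -> odd (l - k) -> l <= uphalf n ->
  exists C, tight n k l (odd l) C.
Proof.
move=> k0 ltkl o len; apply: top_edge_tight.
have [j ej] : exists j, l = k + (j.*2 + 1).
  by exists (l - k)./2; have := odd_double_half (l - k); rewrite o; lia.
rewrite ej; apply: proj1 (@glue_induction (j.*2 + 1) (j.*2.*2 + 1) k _ _ n k (leqnn k) _).
- lia.
- by move=> i /andP[i0 _]; exact: lower_half_top_edge.
(* The bound on [l] says 2l-1 <= n, and 2l-1 = 2k+4j+1. *)
- by move: len; rewrite uphalf_half; have := odd_double_half n; lia.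
Qed.

Lemma hamilton_tight n k l (c := (l - k - 1)./2) : 0 < k -> k < l -> k + l <= n ->
    odd (l - k) ->
    (forall m, c <= m <= (k + l - 1)./2 ->
       has_hamilton_cycle (2 * m + 1) (m - c) (m + 1 + c)) ->
  exists C, tight n k l (odd l) C.
Proof.
move=> k0 ltkl len o ham; apply: top_edge_tight.
have ec : l = k + (c.*2 + 1).
  have := odd_double_half (l - k - 1); rewrite oddB ?subn_gt0 // o /= /c; lia.
rewrite [X in top_edge n k X]ec.
apply: proj1 (@glue_induction (c.*2 + 1) (c.*2 + 1) k _ _ n k (leqnn k) _); [lia| |lia].
move=> i /andP[i0 ik].
(* With m = i+c the levels [m-c, m+1+c] are [i, i+2c+1]. *)
have /has_hamilton_level_cycle := ham (i + c) ltac:(lia).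
have -> : 2 * (i + c) + 1 = i.*2 + (c.*2 + 1) by lia.
have -> : i + c - c = i by lia.
have -> : i + c + 1 + c = i + (c.*2 + 1) by lia.
case=> C /adj_top_edge[|a [b [s [hC wa wb]]]]; first by lia.
by exists a, b, s; split=> //; exact: adj_tight.
Qed.

Theorem theorem8 (n k l : nat) (hn : 3 <= n)
  (hcase :
    (* (i) *)
    ((k = 0 /\ k < l <= n) \/ (k < l /\ l = n)) \/
    (* (ii) *)
    ([/\ 1 <= k, k < l <= n, 2 <= l - k & ~~ odd (l - k)]) \/
    (* (iiia) *)
    ([/\ 1 <= k, k < l <= n - 1 & l - k = 1]) \/
    (* (iiib) *)
    ([/\ [/\ 1 <= k, k < l & l <= uphalf n] \/
         [/\ n./2 <= k, k < l & l <= n - 1],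
         3 <= l - k & odd (l - k)]) \/
    (* (iv) *)
    ([/\ 1 <= k, k < l <= n - 1, 3 <= l - k & odd (l - k)] /\
     let c := (l - k - 1)./2 in
     forall m : nat, c <= m <= (minn (k + l) (2 * n - k - l) - 1)./2 ->
       has_hamilton_cycle (2 * m + 1) (m - c) (m + 1 + c))) :
  exists C : seq (n.-tuple bool), tight_enumeration k l C.
Proof.
suff [p [C /tight_tight_enumeration //]] : exists p C, tight n k l p C.
case: hcase => [[[k0 ltl]|[ltkl el]]|[[k0 ltl le2 ev]|[[k0 ltl e1]|[[hl le3 o]|]]]].
- by subst k; exists (odd l), (gray n 0 l); exact: tight_gray.
- subst l; pose C := gray n 0 (n - k).
  apply: (@tight_compl n k n (odd (n - k)) C (ltnW ltkl) (leqnn n)).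
  by rewrite subnn; apply: tight_gray => //; lia.
- exists (odd l), (gray n k l); apply: tight_gray => // _.
  by move: ev; rewrite oddB; [case: (odd l); case: (odd k)|lia].
- have {e1} el : l = k + 1 by lia.
  case: (leqP (k.*2 + 1) n) => [le|gt].
    by have [C] := two_levels_tight k0 le; rewrite -el; exists (odd l), C.
  have [||C] := @two_levels_tight n (n - l); [lia|lia|].
  have -> : n - l + 1 = n - k by lia.
  by apply: tight_compl; lia.
- case: hl => [[k0 ltkl len]|[lek ltkl len]].
    by have [C] := lower_half_tight k0 ltkl o len; exists (odd l), C.
  have [||||C] := @lower_half_tight n (n - l) (n - k).
  + lia.
  + lia.
  + by have -> : n - k - (n - l) = l - k by lia.
  + by rewrite uphalf_half; have := odd_double_half n; lia.
  by apply: tight_compl; lia.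
- case=> -[k0 ltl le3 o] /= ham.
  case: (leqP (k + l) n) => [le|gt].
    have [|||||C] := @hamilton_tight n k l; rewrite ?le //; [lia| |].
      by move=> m hm; apply: ham; move: hm; rewrite (minn_idPl _) //; lia.
    by exists (odd l), C.
  (* The complement keeps [c] and replaces k+l by 2n-k-l, which is now the minimum. *)
  have elk : n - k - (n - l) = l - k by lia.
  have [|||||C] := @hamilton_tight n (n - l) (n - k); rewrite ?elk //; [lia|lia|lia| |].
    move=> m hm; apply: ham; move: hm; rewrite (minn_idPr _); last by lia.
    by have -> : n - l + (n - k) = 2 * n - k - l by lia.
  by apply: tight_compl; lia.
Qed.
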